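(* Let $(X,\le)$ be a finite poset, $K$ a field, and $\mathcal{J}=J(I(X,K))$ the Jacobson radical of the incidence algebra $I(X,K)$, with product $\cdot$. Then all the totally compatible structures on $(\mathcal{J},\cdot)$ are annihilator-valued if and only if $l(X)\le 2$.
   Context: All products are $K$-bilinear. The incidence algebra $I(X,K)$ is the associative $K$-algebra with basis $\{e_{xy}: x,y\in X,\ x\le y\}$ and multiplication $e_{xy}\cdot e_{uv}=\delta_{yu}e_{xv}$ ($\delta$ is the Kronecker delta). Its Jacobson radical is $\mathcal{J}=\mathrm{span}_K\{e_{xy}: x<y\}$. A chain in $X$ is a nonempty subset $C\subseteq X$ of pairwise comparable elements; its length is $l(C)=|C|-1$. The length of $X$ is $l(X)=\max\{l(C): C\text{ is a chain in }X\}$. Two products $\cdot_1,\cdot_2$ on a vector space $V$ are totally compatible if $(a\cdot_1 b)\cdot_2 c=(a\cdot_2 b)\cdot_1 c=a\cdot_1(b\cdot_2 c)=a\cdot_2(b\cdot_1 c)$ for all $a,b,c\in V$. A totally compatible structure on an associative algebra $(A,\cdot)$ is an associative bilinear product $*$ on $A$ such that $\cdot$ and $*$ are totally compatible. A bilinear product $\bullet$ on $A$ is annihilator-valued (with respect to $\cdot$) if $(A\cdot A)\bullet A=(A\bullet A)\cdot A=A\cdot(A\bullet A)=A\bullet(A\cdot A)=\{0\}$, where a product of subspaces is the span of all products of elements. *)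

(* Defs.v *)
From HB Require Import structures.
From mathcomp Require Import all_boot all_order all_algebra.
From mathcomp Require Import boolp classical_sets.

Set Implicit Arguments.
Unset Strict Implicit.
Unset Printing Implicit Defensive.

Import Order.TTheory GRing.Theory.
Local Open Scope classical_set_scope.
Local Open Scope ring_scope.

Section PosetLength.
Context (d : Order.disp_t) (X : finPOrderType d).

Definition chain (C : {set X}) : bool :=
  (0 < #|C|)%N && [forall x in C, forall y in C, (x >=< y)%O].

(* The empty poset has no chain; its length is 0 by the convention on \max. *)
Definition poset_length : nat := \max_(C : {set X} | chain C) #|C|.-1.

End PosetLength.

Section JacobsonRadical.
Context (A : pzRingType).

Definition left_ideal (M : set A) : Prop :=
  [/\ M 0, forall u v, M u -> M v -> M (u + v) & forall a u, M u -> M (a * u)].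

Definition maximal_left_ideal (M : set A) : Prop :=
  [/\ left_ideal M, M <> setT &
      forall N : set A, left_ideal N -> M `<=` N -> N = M \/ N = setT].

(* For the zero ring the intersection is empty, and the radical is everything. *)
Definition jacobson : set A := \bigcap_(M in maximal_left_ideal) M.

Lemma jacobson_left_ideal : left_ideal jacobson.
Proof.
split.
- by move=> M [[]].
- by move=> u v hu hv M hM; case: (hM) => [[_ h _] _ _]; apply: h; [exact: hu|exact: hv].
- by move=> a u hu M hM; case: (hM) => [[_ _ h] _ _]; apply: h; exact: hu.
Qed.

End JacobsonRadical.

Arguments jacobson A : clear implicits.
Arguments jacobson_left_ideal A : clear implicits.

Section Products.
Context (K : fieldType) (V : lmodType K).
Implicit Types (op mul : V -> V -> V) (S T : set V).

Definition bilinear_op op : Prop := bilinear_for *:%R *:%R op.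

Definition totally_compatible op1 op2 : Prop :=
  forall a b c : V,
    [/\ op2 (op1 a b) c = op1 (op2 a b) c,
        op1 (op2 a b) c = op1 a (op2 b c) &
        op1 a (op2 b c) = op2 a (op1 b c)].

Definition totally_compatible_structure mul op : Prop :=
  [/\ bilinear_op op, associative op & totally_compatible mul op].

Definition lspan S : set V :=
  [set v | exists n (k : 'I_n -> K) (u : 'I_n -> V),
    (forall i, S (u i)) /\ v = \sum_(i < n) k i *: u i].

Definition prod_subspaces op S T : set V :=
  lspan [set v | exists s t, [/\ S s, T t & v = op s t]].

Definition annihilator_valued mul op : Prop :=
  [/\ prod_subspaces op (prod_subspaces mul setT setT) setT = [set 0],
      prod_subspaces mul (prod_subspaces op setT setT) setT = [set 0],
      prod_subspaces mul setT (prod_subspaces op setT setT) = [set 0] &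
      prod_subspaces op setT (prod_subspaces mul setT setT) = [set 0]].

End Products.

(* I(X,K) is the space of functions on X * X supported on the order relation;
   the value of f at (x, y) is its coordinate on e_xy. *)
Section IncidenceAlgebra.
Context (K : fieldType) (d : Order.disp_t) (X : finPOrderType d).

Definition inc_supported : {pred {ffun X * X -> K^o}} :=
  [pred f : {ffun X * X -> K^o} | [forall p, (f p != 0) ==> (p.1 <= p.2)%O]].

Lemma inc_supportedP (f : {ffun X * X -> K^o}) :
  reflect (forall x y, ~~ (x <= y)%O -> f (x, y) = 0) (f \in inc_supported).
Proof.
apply: (iffP forallP) => [h x y|h [x y]] /=.
  by have /= := h (x, y); case: eqP => //= _ ->.
by apply/implyP; apply: contraR => /h ->.
Qed.

Fact inc_supported_closed : submod_closed inc_supported.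
Proof.
split=> [|a f g /inc_supportedP hf /inc_supportedP hg]; apply/inc_supportedP.
  by move=> x y _; rewrite ffunE.
by move=> x y hxy; rewrite !ffunE hf // hg // scaler0 addr0.
Qed.

HB.instance Definition _ :=
  GRing.isSubmodClosed.Build K {ffun X * X -> K^o} inc_supported
    inc_supported_closed.

Record incalg := IncAlg {
  inc_ffun : {ffun X * X -> K^o};
  inc_ffunP : inc_ffun \in inc_supported }.

HB.instance Definition _ := [isSub for inc_ffun].
HB.instance Definition _ := [Choice of incalg by <:].
HB.instance Definition _ := [SubChoice_isSubLmodule of incalg by <:].

Definition icoef (f : incalg) (x y : X) : K := inc_ffun f (x, y).

Lemma icoef0P (f : incalg) x y : ~~ (x <= y)%O -> icoef f x y = 0.
Proof. by move: x y; apply/inc_supportedP/inc_ffunP. Qed.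

Lemma icoef_inj (f g : incalg) : (forall x y, icoef f x y = icoef g x y) -> f = g.
Proof. by move=> h; apply/val_inj/ffunP => -[x y]; apply: h. Qed.

Lemma icoef0 x y : icoef 0 x y = 0. Proof. by rewrite /icoef ffunE. Qed.
Lemma icoefD f g x y : icoef (f + g) x y = icoef f x y + icoef g x y.
Proof. by rewrite /icoef ffunE. Qed.
Lemma icoefZ k f x y : icoef (k *: f) x y = k * icoef f x y.
Proof. by rewrite /icoef ffunE. Qed.
Lemma icoefN f x y : icoef (- f) x y = - icoef f x y.
Proof. by rewrite -scaleN1r icoefZ mulN1r. Qed.
Lemma icoef_sum I (r : seq I) (P : pred I) (F : I -> incalg) x y :
  icoef (\sum_(i <- r | P i) F i) x y = \sum_(i <- r | P i) icoef (F i) x y.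
Proof.
by apply: (big_morph (fun f => icoef f x y)) => [f g|]; [exact: icoefD|exact: icoef0].
Qed.

Fact inc_mk_subproof (F : X -> X -> K) :
  [ffun p => if (p.1 <= p.2)%O then F p.1 p.2 else 0] \in inc_supported.
Proof. by apply/inc_supportedP => x y /negPf h; rewrite ffunE /= h. Qed.

Definition inc_mk (F : X -> X -> K) : incalg := IncAlg (inc_mk_subproof F).

Lemma icoef_mk F x y : icoef (inc_mk F) x y = if (x <= y)%O then F x y else 0.
Proof. by rewrite /icoef ffunE. Qed.

Definition inc_one : incalg := inc_mk (fun x y => (x == y)%:R).
Definition inc_mul (f g : incalg) : incalg :=
  inc_mk (fun x y => \sum_(z : X) icoef f x z * icoef g z y).

Lemma icoef_one x y : icoef inc_one x y = (x == y)%:R.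
Proof. by rewrite icoef_mk; case: eqP => [->|_]; rewrite ?lexx ?if_same. Qed.

Lemma icoef_mul f g x y :
  icoef (inc_mul f g) x y = \sum_(z : X) icoef f x z * icoef g z y.
Proof.
rewrite icoef_mk; case: ifP => // /negbT hxy; apply/esym/big1 => z _.
have [hxz|/icoef0P->] := boolP (x <= z)%O; last exact: mul0r.
rewrite (@icoef0P g) ?mulr0 //; apply: contra hxy; exact: le_trans.
Qed.

Fact inc_mulA : associative inc_mul.
Proof.
move=> f g h; apply: icoef_inj => x y; rewrite !icoef_mul.
under eq_bigr do rewrite icoef_mul mulr_sumr.
rewrite exchange_big; apply: eq_bigr => z _ /=; rewrite icoef_mul mulr_suml.
by apply: eq_bigr => t _; rewrite mulrA.
Qed.

Fact inc_mul1 : left_id inc_one inc_mul.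
Proof.
move=> f; apply: icoef_inj => x y; rewrite icoef_mul (bigD1 x) //= icoef_one eqxx.
rewrite mul1r big1 ?addr0 // => z /negPf zx.
by rewrite icoef_one eq_sym zx mul0r.
Qed.

Fact inc_mulr1 : right_id inc_one inc_mul.
Proof.
move=> f; apply: icoef_inj => x y; rewrite icoef_mul (bigD1 y) //= icoef_one eqxx.
by rewrite mulr1 big1 ?addr0 // => z /negPf zy; rewrite icoef_one zy mulr0.
Qed.

Fact inc_mulDl : left_distributive inc_mul +%R.
Proof.
move=> f g h; apply: icoef_inj => x y; rewrite icoefD !icoef_mul -big_split.
by apply: eq_bigr => z _; rewrite icoefD mulrDl.
Qed.

Fact inc_mulDr : right_distributive inc_mul +%R.
Proof.
move=> f g h; apply: icoef_inj => x y; rewrite icoefD !icoef_mul -big_split.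
by apply: eq_bigr => z _; rewrite icoefD mulrDr.
Qed.

(* I(X,K) is the zero ring when X is empty, hence no nzRingType instance. *)
HB.instance Definition _ := GRing.Zmodule_isPzRing.Build incalg
  inc_mulA inc_mul1 inc_mulr1 inc_mulDl inc_mulDr.

Lemma icoefM (f g : incalg) x y :
  icoef (f * g) x y = \sum_(z : X) icoef f x z * icoef g z y.
Proof. exact: icoef_mul. Qed.

Lemma icoef1 x y : icoef 1 x y = (x == y)%:R.
Proof. exact: icoef_one. Qed.

Lemma inc_scalerAl (k : K) (f g : incalg) : k *: (f * g) = (k *: f) * g.
Proof.
apply: icoef_inj => x y; rewrite icoefZ !icoefM mulr_sumr.
by apply: eq_bigr => z _; rewrite icoefZ mulrA.
Qed.

Lemma inc_scalerAr (k : K) (f g : incalg) : k *: (f * g) = f * (k *: g).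
Proof.
apply: icoef_inj => x y; rewrite icoefZ !icoefM mulr_sumr.
by apply: eq_bigr => z _; rewrite icoefZ mulrCA.
Qed.

(* e_xy; it is 0 unless x <= y. *)
Definition ibasis (x y : X) : incalg :=
  inc_mk (fun u v => ((u == x) && (v == y))%:R).

Lemma icoef_basis x y u v : (x <= y)%O ->
  icoef (ibasis x y) u v = ((u == x) && (v == y))%:R.
Proof.
by move=> xy; rewrite icoef_mk; case: andP => [[/eqP-> /eqP->]|]; rewrite ?xy ?if_same.
Qed.

Lemma inc_basis_sum (f : incalg) :
  f = \sum_(p : X * X | (p.1 <= p.2)%O) icoef f p.1 p.2 *: ibasis p.1 p.2.
Proof.
apply: icoef_inj => x y; rewrite icoef_sum.
have [xy|nxy] := boolP (x <= y)%O.
  rewrite (bigD1 (x, y)) //= icoefZ icoef_basis // !eqxx mulr1 big1 ?addr0 //.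
  move=> [u v] /andP[/= uv ne]; rewrite icoefZ icoef_basis //.
  by rewrite -xpair_eqE eq_sym (negPf ne) mulr0.
rewrite icoef0P // big1 // => -[u v] /= uv; rewrite icoefZ icoef_basis //.
by case: andP => [[/eqP ex /eqP ey]|]; rewrite ?mulr0 //; rewrite ex ey uv in nxy.
Qed.

Lemma inc_basisM x y u v : (x <= y)%O -> (u <= v)%O ->
  ibasis x y * ibasis u v = (y == u)%:R *: ibasis x v.
Proof.
move=> xy uv; apply: icoef_inj => a b; rewrite icoefM icoefZ (bigD1 y) //=.
rewrite big1 ?addr0 => [|z /negPf zy]; last first.
  by rewrite icoef_basis // zy andbF mul0r.
rewrite (icoef_basis _ _ xy) (icoef_basis _ _ uv) eqxx andbT.
have [yu|_] := eqVneq y u; last by rewrite mulr0 mul0r.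
rewrite icoef_basis ?mul1r ?(le_trans xy) ?yu //.
by case: (a == x); rewrite ?mul1r ?mul0r.
Qed.

Lemma icoefM_diag (f g : incalg) x : icoef (f * g) x x = icoef f x x * icoef g x x.
Proof.
rewrite icoefM (bigD1 x) //= big1 ?addr0 // => z zx.
have [xz|/icoef0P->] := boolP (x <= z)%O; last exact: mul0r.
rewrite (@icoef0P g) ?mulr0 //; apply: contra zx => zx; by rewrite eq_le zx xz.
Qed.

Lemma inc_nilpotent (g : incalg) : (forall x, icoef g x x = 0) -> g ^+ #|X|.+1 = 0.
Proof.
move=> g0; pose h (x : X) := #|[pred z | (z <= x)%O]|.
have hlt x y : (x < y)%O -> (h x < h y)%N.
  move=> xy; apply: proper_card; apply/properP; split.
    by apply/fintype.subsetP => z; rewrite !inE => /le_trans -> //; exact: ltW.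
  by exists y; rewrite !inE ?lexx // lt_geF.
have hk k x y : icoef (g ^+ k) x y != 0 -> (h x + k <= h y)%N.
  elim: k x => [|k IH] x.
    by rewrite expr0 icoef1 addn0; case: (eqVneq x y) => [->|] //=; rewrite eqxx.
  rewrite exprS icoefM => /eqP ne.
  have [z] : exists z, icoef g x z * icoef (g ^+ k) z y != 0.
    apply/existsP; apply: contra_notT ne => /existsPn hz.
    by apply: big1 => z _; have /negbNE/eqP := hz z.
  rewrite mulf_eq0 negb_or => /andP[gxz /IH]; apply: leq_trans.
  rewrite addnS -addSn leq_add2r hlt // lt_neqAle; apply/andP; split.
    by apply: contraNneq gxz => ->; rewrite g0.
  by apply: contraNT gxz => /icoef0P->.
apply: icoef_inj => x y; rewrite icoef0; apply: contraTeq isT => /hk.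
by rewrite addnS ltnNge (leq_trans (max_card _) (leq_addl _ _)).
Qed.

(* The Jacobson radical is the span of the e_xy with x < y. *)
Lemma inc_jacobsonP (f : incalg) :
  f \in jacobson incalg <-> forall x, icoef f x x = 0.
Proof.
rewrite in_setE; split=> [hf x|f0 M hM].
  pose M : set incalg := [set g | icoef g x x = 0].
  apply: (hf M); split.
  - split=> [|u v|a u]; rewrite /M /= ?icoef0 ?icoefD ?icoefM_diag //.
      by move=> -> ->; rewrite addr0.
    by move=> ->; rewrite mulr0.
  - move=> MT; have : M 1 by rewrite MT.
    by rewrite /M /= icoef1 eqxx => /eqP; rewrite oner_eq0.
  move=> N [N0 ND NM] MN; have [NsM|] := pselect (N `<=` M).
    by left; apply/seteqP.
  move=> /existsNP[u /not_implyP[Nu /eqP ux]]; right; apply/seteqP; split=> // g _.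
  pose v := (icoef g x x / icoef u x x) *: u.
  rewrite -(subrK v g); apply: ND.
    by apply: MN; rewrite /M /= icoefD icoefN icoefZ mulfVK // subrr.
  by rewrite /v -[u]mul1r inc_scalerAl; apply: NM.
case: (hM) => -[M0 MD MM] MT max; apply: contrapT => nMf.
pose N : set incalg := [set u | exists m a, M m /\ u = m + a * f].
have [|m Mm|NM|NT] := max N.
- split.
  + by exists 0, 0; rewrite mul0r addr0.
  + move=> _ _ [m [a [Mm ->]]] [m' [a' [Mm' ->]]].
    by exists (m + m'), (a + a'); split; [exact: MD|rewrite mulrDl addrACA].
  + move=> b _ [m [a [Mm ->]]]; exists (b * m), (b * a).
    by split; [exact: MM|rewrite mulrDr mulrA].
- by exists m, 0; rewrite mul0r addr0.
- by apply: nMf; rewrite -NM; exists 0, 1; rewrite mul1r add0r.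
have [m [a [Mm e1]]] : N 1 by rewrite NT.
have M1g k : M (1 - (a * f) ^+ k).
  elim: k => [|k IH]; first by rewrite expr0 subrr.
  have -> : 1 - (a * f) ^+ k.+1 = (1 - (a * f) ^+ k) + (a * f) ^+ k * m.
    have -> : m = 1 - a * f by rewrite e1 addrK.
    by rewrite mulrBr mulr1 -exprSr addrA subrK.
  by apply: MD => //; apply: MM.
apply: MT; apply/seteqP; split=> // u _; rewrite -[u]mulr1; apply: MM.
have := M1g #|X|.+1; rewrite inc_nilpotent ?subr0 // => x.
by rewrite icoefM_diag f0 mulr0.
Qed.

(* The Jacobson radical of I(X,K) as a K-algebra without unit. *)
Record jradical := JRadical {
  jval : incalg;
  jvalP : jval \in jacobson incalg }.

HB.instance Definition _ := [isSub for jval].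
HB.instance Definition _ := [Choice of jradical by <:].

Fact jacobson_submod_closed :
  submod_closed [pred f : incalg | f \in jacobson incalg].
Proof.
have [h0 hD hM] := jacobson_left_ideal incalg.
split=> [|a f g]; rewrite !inE ?in_setE // => hf hg.
by apply: hD => //; rewrite -[f]mul1r inc_scalerAl; apply: hM.
Qed.

HB.instance Definition _ :=
  GRing.SubChoice_isSubLmodule.Build K incalg _ jradical jacobson_submod_closed.

Fact jmul_subproof (f g : jradical) : jval f * jval g \in jacobson incalg.
Proof.
have [_ _ hM] := jacobson_left_ideal incalg.
by rewrite in_setE; apply: hM; rewrite -in_setE; apply: jvalP.
Qed.

Definition jmul (f g : jradical) : jradical := JRadical (jmul_subproof f g).

End IncidenceAlgebra.

(* Main.v *)
(* Compatibility gives (a . b) * c = (a * b) . c = a . (b * c) = a * (b . c) =: T(a, b, c).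
   On basis elements, T(e_xy, e_uv, e_pq) vanishes if y <> u (since then
   e_xy . e_uv = 0) and if v <> p (since then e_uv . e_pq = 0); in the remaining
   case x < y < v < q is a chain of length 3. Conversely * := . is a totally
   compatible structure, and e_xy . e_yz . e_zw = e_xw is nonzero for
   x < y < z < w. *)
Require Import Defs.
From HB Require Import structures.
From mathcomp Require Import all_boot all_order all_algebra.
From mathcomp Require Import boolp classical_sets.

Set Implicit Arguments.
Unset Strict Implicit.
Unset Printing Implicit Defensive.

Import Order.TTheory GRing.Theory.
Local Open Scope classical_set_scope.
Local Open Scope ring_scope.

Section FourChains.
Context (d : Order.disp_t) (X : finPOrderType d).

Lemma four_chain_poset_length (x y z w : X) :
  (x < y)%O -> (y < z)%O -> (z < w)%O -> (2 < poset_length X)%N.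
Proof.
move=> xy yz zw.
have lt_s : sorted <%O [:: x; y; z; w] by rewrite /= xy yz zw.
pose C : {set X} := [set:: [:: x; y; z; w]].
have cardC : #|C| = 4.
  rewrite cardsE; apply/card_uniqP; exact: lt_sorted_uniq lt_s.
have chainC : chain C.
  rewrite /chain cardC /=; apply/forall_inP => a; rewrite inE => aC.
  apply/forall_inP => b; rewrite inE => bC.
  have [xz yw] := (lt_trans xy yz, lt_trans yz zw).
  have xw := lt_trans xy yw.
  move: aC bC; rewrite !inE.
  by case/or4P=> /eqP->; case/or4P=> /eqP->; rewrite /Order.comparable ?lexx //
    (ltW xy, ltW xz, ltW xw, ltW yz, ltW yw, ltW zw) ?orbT.
by apply: (bigop.bigmax_sup C) => //; rewrite cardC.
Qed.

(** If no such quadruple existed, every chain would have at most three elements, which bounds the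
    maximum by 2. A larger chain, listed in increasing order, begins with the required elements. *)
Lemma poset_length_four_chain : (2 < poset_length X)%N ->
  exists x y z w : X, [/\ (x < y)%O, (y < z)%O & (z < w)%O].
Proof.
rewrite ltnNge => /negP len; apply: contrapT => noch; apply: len.
apply/bigmax_leqP => C /andP[_ /forall_inP chC].
rewrite leqNgt; apply/negP => Cgt; apply: noch.
(* Pairwise comparability makes the order total on [C], so sorting its enumeration really gives a
   sorted list; the absence of repetitions then makes it strictly increasing. *)
have tot : {in C &, total (<=%O : rel X)}.
  by move=> a b aC bC; have /forall_inP := chC a aC; apply.
have srt : sorted <=%O (sort <=%O (enum C)).
  by apply: (sort_sorted_in tot); apply/allP => a; rewrite mem_enum.
have : sorted <%O (sort <=%O (enum C)).
  by rewrite lt_sorted_uniq_le sort_uniq enum_uniq.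
have : (3 < size (sort <=%O (enum C)))%N.
  by rewrite size_sort -cardE; case: #|C| Cgt.
case: (sort _ _) => [|x [|y [|z [|w s]]]] //= _ /and4P[xy yz zw _].
by exists x, y, z, w.
Qed.

End FourChains.

Section ProductsOfSubspaces.
Context (K : fieldType) (V : lmodType K).
Implicit Types (op mul : V -> V -> V) (S T : set V).

Lemma lspan_sub S : S `<=` lspan S.
Proof.
move=> v Sv; exists 1%N, (fun=> 1), (fun=> v); split=> //.
by rewrite big_ord1 scale1r.
Qed.

(** Triple products of subspaces are spans over spans. With [g] a left or right multiplication, this
    reduces their vanishing to products of elements. *)
Lemma lspan_linear0 S (g : V -> V) : linear g ->
  (forall v, S v -> g v = 0) -> forall v, lspan S v -> g v = 0.
Proof.
move=> lin_g g0 _ [n [k [u [Su ->]]]].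
pose gL : {linear V -> V} := HB.pack g (GRing.isLinear.Build _ _ _ _ g lin_g).
rewrite -[g]/(gL : V -> V) linear_sum big1 // => i _.
by rewrite linearZ /= g0 ?scaler0.
Qed.

Lemma prod_subspaces_eq0 op S T :
  prod_subspaces op S T = [set 0] <->
  forall s t, S s -> T t -> op s t = 0.
Proof.
split=> [e s t Ss Tt|op0].
  have : prod_subspaces op S T (op s t) by apply: lspan_sub; exists s, t.
  by rewrite e.
apply/seteqP; split=> [v|_ ->].
  (* The identity serves as the linear map: all generators are 0, hence so is their span. *)
  apply: (@lspan_linear0 _ id) => [a x y //|w [s [t [Ss Tt ->]]]]; exact: op0.
(* The empty combination puts 0 in the span, even when [S] or [T] is empty. *)
by exists 0%N, (fun=> 0), (fun=> 0); split=> [[]//|]; rewrite big_ord0.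
Qed.

Lemma bilinear_opl op b : bilinear_op op -> linear (op^~ b).
Proof. by case. Qed.

Lemma bilinear_opr op a : bilinear_op op -> linear (op a).
Proof. by case. Qed.

Lemma bilinear_op0l op b : bilinear_op op -> op 0 b = 0.
(* Linearity at scalar -1 and two zero vectors reads [op 0 b = - op 0 b + op 0 b]. *)
Proof. by case=> /(_ b (-1) 0 0) + _; rewrite /= !scaleN1r !addNr. Qed.

Lemma bilinear_op0r op a : bilinear_op op -> op a 0 = 0.
Proof. by case=> _ /(_ a (-1) 0 0); rewrite /= !scaleN1r !addNr. Qed.

Lemma prod_subspaces3l_eq0 op mul : bilinear_op op ->
  (forall a b c, op (mul a b) c = 0) ->
  prod_subspaces op (prod_subspaces mul setT setT) setT = [set 0].
Proof.
move=> bil op0; apply/prod_subspaces_eq0 => s c + _.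
apply: (lspan_linear0 (bilinear_opl c bil)) => _ [a [b [_ _ ->]]]; exact: op0.
Qed.

Lemma prod_subspaces3r_eq0 op mul : bilinear_op op ->
  (forall a b c, op a (mul b c) = 0) ->
  prod_subspaces op setT (prod_subspaces mul setT setT) = [set 0].
Proof.
move=> bil op0; apply/prod_subspaces_eq0 => a s _.
apply: (lspan_linear0 (bilinear_opr a bil)) => _ [b [c [_ _ ->]]]; exact: op0.
Qed.

(** Total compatibility identifies the four mixed triple products, so the vanishing of one forces
    that of the other three. *)
Lemma totally_compatible_annihilator_valued mul op :
  bilinear_op mul -> totally_compatible_structure mul op ->
  (forall a b c, op (mul a b) c = 0) -> annihilator_valued mul op.
Proof.
move=> bmul [bop _ compat] op0.
have mul0l a b c : mul (op a b) c = 0 by have [<- _ _] := compat a b c.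
have mul0r a b c : mul a (op b c) = 0 by have [_ <- _] := compat a b c.
have op0r a b c : op a (mul b c) = 0 by have [_ _ <-] := compat a b c.
by split; [exact: prod_subspaces3l_eq0 | exact: prod_subspaces3l_eq0
  | exact: prod_subspaces3r_eq0 | exact: prod_subspaces3r_eq0].
Qed.

End ProductsOfSubspaces.

Section RadicalOfIncidenceAlgebra.
Context (K : fieldType) (d : Order.disp_t) (X : finPOrderType d).
Local Notation J := (jradical K X).

Lemma jmul_bilinear : bilinear_op (@jmul K d X).
Proof.
split=> [a k b c|a k b c]; apply: val_inj => /=.
  by rewrite mulrDl inc_scalerAl.
by rewrite mulrDr inc_scalerAr.
Qed.

Lemma jmulA : associative (@jmul K d X).
Proof. by move=> a b c; apply: val_inj; rewrite /= mulrA. Qed.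

(* The default value of insubd makes this 0 unless x < y. *)
Definition jbasis (x y : X) : J := insubd 0 (ibasis K x y).

Lemma jval_jbasis x y : (x < y)%O -> jval (jbasis x y) = ibasis K x y.
Proof.
move=> xy; rewrite -[jval _]/(val _) insubdK //.
apply/inc_jacobsonP => z; rewrite icoef_basis ?ltW //.
by case: eqP => //= ->; rewrite lt_eqF.
Qed.

Lemma jmul_jbasis x y u v : (x < y)%O -> (u < v)%O ->
  jmul (jbasis x y) (jbasis u v) = (y == u)%:R *: jbasis x v.
Proof.
move=> xy uv; apply: val_inj; rewrite /= (jval_jbasis xy) (jval_jbasis uv) inc_basisM ?ltW //.
have [yu|_] := eqVneq y u; last by rewrite !scale0r.
by rewrite jval_jbasis // (lt_trans xy) // yu.
Qed.

Lemma jbasis_neq0 x y : (x < y)%O -> jbasis x y != 0.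
Proof.
move=> xy; apply: contraTneq isT => /(congr1 (fun f : J => icoef (jval f) x y)).
rewrite jval_jbasis // icoef_basis ?ltW // !eqxx icoef0 => /eqP.
by rewrite oner_eq0.
Qed.

Lemma jbasis_sum (f : J) :
  f = \sum_(p : X * X | (p.1 < p.2)%O)
        icoef (jval f) p.1 p.2 *: jbasis p.1 p.2.
Proof.
apply: val_inj; rewrite raddf_sum /= [LHS]inc_basis_sum.
(* The expansion over all pairs [x <= y] splits into diagonal and strict pairs; elements of the
   radical have zero diagonal coefficients. *)
rewrite (bigID (fun p : X * X => (p.1 == p.2))) /= big1 ?add0r => [|p].
  apply: eq_big => [p|p /andP[le_p ne_p]]; first by rewrite lt_neqAle andbC.
  by rewrite jval_jbasis // lt_neqAle ne_p.
case/andP=> _ /eqP <-; have /inc_jacobsonP-> := jvalP f; exact: scale0r.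
Qed.

(** Applied to each argument in turn, this reduces a trilinear identity to basis elements. *)
Lemma jradical_linear_eq0 (g : J -> J) : linear g ->
  (forall x y, (x < y)%O -> g (jbasis x y) = 0) -> forall f, g f = 0.
Proof.
move=> lin_g g0 f.
pose gL : {linear J -> J} := HB.pack g (GRing.isLinear.Build _ _ _ _ g lin_g).
rewrite -[g]/(gL : J -> J) [f]jbasis_sum linear_sum big1 // => p lt_p.
by rewrite linearZ /= g0 ?scaler0.
Qed.

Lemma length_le2_op_jmul (op : J -> J -> J) :
  (poset_length X <= 2)%N -> totally_compatible_structure (@jmul K d X) op ->
  forall a b c, op (jmul a b) c = 0.
Proof.
move=> len [bop _ compat] a b c.
have [jl jr] := jmul_bilinear; have [ol or] := bop.
move: a; apply: jradical_linear_eq0 => [k a a'|x y xy].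
  by rewrite jl ol.
move: b; apply: jradical_linear_eq0 => [k b b'|u v uv].
  by rewrite jr ol.
move: c; apply: jradical_linear_eq0 => [k c c'|p q pq].
  by rewrite or.
have [yu|yu] := eqVneq y u; last first.
  by rewrite jmul_jbasis // (negPf yu) scale0r bilinear_op0l.
have [vp|vp] := eqVneq v p; last first.
  (* The three equalities carry [op (jmul a b) c] to [op a (jmul b c)], where the inner product is 0
     because [v != p]. *)
  have [-> -> ->] := compat (jbasis x y) (jbasis u v) (jbasis p q).
  by rewrite jmul_jbasis // (negPf vp) scale0r bilinear_op0r.
rewrite -{}yu in uv; rewrite -{}vp in pq.
by move: (four_chain_poset_length xy uv pq); rewrite ltnNge len.
Qed.

End RadicalOfIncidenceAlgebra.

Theorem proposition5p19 (d : Order.disp_t) (X : finPOrderType d) (K : fieldType) :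
  (forall op : jradical K X -> jradical K X -> jradical K X,
     totally_compatible_structure (@jmul K d X) op ->
     annihilator_valued (@jmul K d X) op) <->
  (poset_length X <= 2)%N.
Proof.
split=> [all_ann|len op tcs]; last first.
  apply: totally_compatible_annihilator_valued => //; first exact: jmul_bilinear.
  exact: length_le2_op_jmul.
have [] := all_ann (@jmul K d X).
  split; [exact: jmul_bilinear | exact: jmulA | move=> a b c].
  by rewrite !jmulA.
move=> /prod_subspaces_eq0 J3 _ _ _.
rewrite leqNgt; apply/negP => /poset_length_four_chain.
case=> [x [y [z [w [xy yz zw]]]]].
have xz := lt_trans xy yz.
have /eqP : jmul (jmul (jbasis K x y) (jbasis K y z)) (jbasis K z w) = 0.
  (* [J3] says that the span of all products annihilates the radical from the left; the inner
     product is one of its generators. *)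
  by apply: J3 => //; apply: lspan_sub; exists (jbasis K x y), (jbasis K y z).
rewrite !(jmul_jbasis, eqxx, scale1r) // (negPf (jbasis_neq0 _ _)) //.
exact: lt_trans zw.
Qed.
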